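(* Consider an instance of the two-machine flow shop problem $F2\,||\,C_{\max}$ with $n$ jobs, indexed $1,\dots,n$ according to Johnson's sequence, with $A=\{1,\dots,n_A\}$ and $B=\{n_A+1,\dots,n\}$. Suppose that $P_2\le P_1-p^{\max}_{A1}$, and let $k_B\in\{n_A+1,\dots,n\}$ be the largest index in $B$ (assumed to exist) such that $$\sum_{i\in B:\ p_{2,i}\le p_{2,k_B}} p_{2,i}\ \le\ \sum_{i\in B:\ p_{2,i}\le p_{2,k_B}} p_{1,i}\;-\;p^{\max}_{B2}\qquad\text{and}\qquad p_{2,k_B}<p_{2,k_B-1},$$ where the second condition is regarded as satisfied if $k_B=n_A+1$. Then an optimal schedule is obtained by first sequencing the jobs of set $A$ in any order, followed by jobs $n_A+1,\dots,k_B-1$ in any order, and finally by jobs $k_B,\dots,n$ in this (Johnson's) order. Moreover, if $(n-k_B+1)\log(n-k_B+1)\le n$, then an optimal solution to $F2\,||\,C_{\max}$ can be computed in linear time $O(n)$.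
   Context: Two-machine flow shop $F2\,||\,C_{\max}$: a finite set of $n$ jobs must be processed first on machine $M_1$ and then on machine $M_2$; job $j$ requires processing time $p_{1,j}\ge 0$ on $M_1$ and $p_{2,j}\ge 0$ on $M_2$. All jobs are available at time $0$, each machine processes at most one job at a time, preemption is not allowed, and a job can start on $M_2$ only after completing on $M_1$. The goal is to minimize the makespan $C_{\max}$, i.e. the latest completion time on $M_2$. A sequence (permutation) of the jobs defines the permutation schedule in which both machines process the jobs in that order, each operation starting as early as possible. A schedule is optimal if its makespan is minimum among all feasible schedules (it is well known that some permutation schedule attains this minimum). Johnson's sequence: $A$ is the set of jobs with $p_{1,j}\le p_{2,j}$ and $B$ the set of jobs with $p_{1,j}>p_{2,j}$; first come the jobs of $A$ in nondecreasing order of $p_{1,j}$, then the jobs of $B$ in nonincreasing order of $p_{2,j}$ (ties broken arbitrarily). Jobs are indexed so that Johnson's sequence is $1,2,\dots,n$, with $A=\{1,\dots,n_A\}$ and $B=\{n_A+1,\dots,n\}$. This indexing is only for notation: the input of an algorithm is the list of pairs $(p_{1,j},p_{2,j})$ in arbitrary (unsorted) order. Running time counts arithmetic operations and comparisons on processing times at unit cost; $\log$ is to a fixed base greater than $1$ (e.g. base $2$). ''Computed in linear time'' means that there is one algorithm and one constant $c$ such that on every instance satisfying the hypotheses it outputs an optimal sequence after at most $c\,n$ operations. Notation: $P_1=\sum_{i=1}^n p_{1,i}$, $P_2=\sum_{i=1}^n p_{2,i}$, $p^{\max}_{A1}=\max_{i\in A}p_{1,i}$, $p^{\max}_{B2}=\max_{i\in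 B}p_{2,i}$ (a maximum over the empty set is $0$). *)

(* Defs.v *)
From mathcomp Require Import all_boot all_order all_algebra perm.
From mathcomp Require Import reals exp.

Set Implicit Arguments.
Unset Strict Implicit.
Unset Printing Implicit Defensive.

Import Order.TTheory GRing.Theory Num.Theory.
Local Open Scope ring_scope.

(* Jobs are the elements of 'I_n, so indices and positions start at 0: job j  *)
(* of 'I_n is job j + 1 of the usual numbering 1, ..., n.                     *)
Record flowshop (R : realType) (n : nat) := Flowshop {
  p1 : 'I_n -> R;
  p2 : 'I_n -> R;
  p1_ge0 : forall j, 0 <= p1 j;
  p2_ge0 : forall j, 0 <= p2 j }.

(* The same jobs, renumbered: the new job j is the old job s j. *)
Definition relabel (R : realType) (n : nat) (I : flowshop R n) (s : 'S_n) :
    flowshop R n :=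
  Flowshop (fun j => p1_ge0 I (s j)) (fun j => p2_ge0 I (s j)).

Section Schedules.
Variables (R : realType) (n : nat) (I : flowshop R n).

(* Without preemption a schedule is given by the starting times. *)
Record schedule := Schedule { start1 : 'I_n -> R; start2 : 'I_n -> R }.

Definition one_at_a_time (p S : 'I_n -> R) : Prop :=
  forall i j, i != j -> S i + p i <= S j \/ S j + p j <= S i.

Definition feasible (S : schedule) : Prop :=
  [/\ forall j, 0 <= start1 S j,
      forall j, start1 S j + p1 I j <= start2 S j,
      one_at_a_time (p1 I) (start1 S)
    & one_at_a_time (p2 I) (start2 S)].

Definition makespan (S : schedule) : R :=
  \big[Num.max/0]_(j < n) (start2 S j + p2 I j).

Definition optimal (S : schedule) : Prop :=
  feasible S /\ forall S', feasible S' -> makespan S <= makespan S'.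

Definition job_sequence (s : seq 'I_n) : Prop := perm_eq s (enum 'I_n).

(* Times at which M1 and M2 become free once they have processed the jobs of  *)
(* s in this order, each operation starting as early as possible.             *)
Definition release (s : seq 'I_n) : R * R :=
  foldl (fun t j => (t.1 + p1 I j, Num.max t.2 (t.1 + p1 I j) + p2 I j))
        (0, 0) s.

(* [take (index j s) s] lists the jobs that precede j in s. *)
Definition perm_schedule (s : seq 'I_n) : schedule :=
  let before j := release (take (index j s) s) in
  {| start1 := fun j => (before j).1;
     start2 := fun j => Num.max (before j).2 ((before j).1 + p1 I j) |}.

End Schedules.

Section Johnson.
Variables (R : realType) (n : nat) (I : flowshop R n).

Definition jobsA : {set 'I_n} := [set j | p1 I j <= p2 I j].
Definition jobsB : {set 'I_n} := [set j | p2 I j < p1 I j].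
Definition nA : nat := #|jobsA|.

(* 0, 1, ..., n - 1 is a Johnson sequence. *)
Definition johnson_indexed : Prop :=
  [/\ forall j : 'I_n, (j \in jobsA) = (j < nA)%N,
      {in jobsA &, forall i j : 'I_n, (i <= j)%N -> p1 I i <= p1 I j}
    & {in jobsB &, forall i j : 'I_n, (i <= j)%N -> p2 I j <= p2 I i}].

Definition total1 : R := \sum_(i < n) p1 I i.
Definition total2 : R := \sum_(i < n) p2 I i.
Definition pmaxA1 : R := \big[Num.max/0]_(i in jobsA) p1 I i.
Definition pmaxB2 : R := \big[Num.max/0]_(i in jobsB) p2 I i.

(* The last clause is vacuous when k is the first job of B, i.e., k = nA. *)
Definition kB_condition (k : 'I_n) : Prop :=
  [/\ k \in jobsB,
      \sum_(i in jobsB | p2 I i <= p2 I k) p2 I i <=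
        \sum_(i in jobsB | p2 I i <= p2 I k) p1 I i - pmaxB2
    & forall j : 'I_n, (nA <= j)%N -> j.+1 = k -> p2 I k < p2 I j].

Definition is_kB (k : 'I_n) : Prop :=
  kB_condition k /\ forall k', kB_condition k' -> (k' <= k)%N.

End Johnson.

Definition log (R : realType) (b x : R) : R := ln x / ln b.

(* Programs of a real RAM, as a structured imperative language. The memory    *)
(* consists of arrays of natural numbers and arrays of elements of R, all     *)
(* infinite and zero outside the input; a scalar variable is cell 0 of an     *)
(* array. Elements of R can only be added, subtracted, copied and compared,   *)
(* so they influence addresses and control only through comparisons.          *)
Inductive iexp : Type :=
| IConst of nat
| IGet of nat & iexp            (* IGet a e: cell e of index array a *)
| IAdd of iexp & iexp
| ISub of iexp & iexp.          (* truncated *)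

Inductive rexp : Type :=
| RZero
| RGet of nat & iexp            (* RGet a e: cell e of real array a *)
| RAdd of rexp & rexp
| RSub of rexp & rexp.

Inductive bexp : Type :=
| BLeI of iexp & iexp
| BLeR of rexp & rexp
| BNot of bexp
| BAnd of bexp & bexp.

Inductive cmd : Type :=
| CSkip
| CSetI of nat & iexp & iexp    (* CSetI a e e': (index array a)[e] := e' *)
| CSetR of nat & iexp & rexp    (* CSetR a e e': (real array a)[e] := e' *)
| CSeq of cmd & cmd
| CIf of bexp & cmd & cmd
| CWhile of bexp & cmd.

Section Semantics.
Variable R : realType.

Record memory := Memory { imem : nat -> nat -> nat; rmem : nat -> nat -> R }.

Definition update (T : Type) (f : nat -> nat -> T) (a i : nat) (x : T) :=
  fun a' i' => if (a' == a) && (i' == i) then x else f a' i'.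

Fixpoint ieval (m : memory) (e : iexp) : nat :=
  match e with
  | IConst k => k
  | IGet a e => imem m a (ieval m e)
  | IAdd e e' => (ieval m e + ieval m e')%N
  | ISub e e' => (ieval m e - ieval m e')%N
  end.

Fixpoint reval (m : memory) (e : rexp) : R :=
  match e with
  | RZero => 0
  | RGet a e => rmem m a (ieval m e)
  | RAdd e e' => reval m e + reval m e'
  | RSub e e' => reval m e - reval m e'
  end.

Fixpoint beval (m : memory) (e : bexp) : bool :=
  match e with
  | BLeI e e' => (ieval m e <= ieval m e')%N
  | BLeR e e' => reval m e <= reval m e'
  | BNot e => ~~ beval m e
  | BAnd e e' => beval m e && beval m e'
  end.

(* Every node of an expression costs 1, whatever its kind: bookkeeping on     *)
(* indices is charged as well as operations on processing times.              *)
Fixpoint icost (e : iexp) : nat :=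
  match e with
  | IConst _ => 1
  | IGet _ e => (icost e).+1
  | IAdd e e' | ISub e e' => (icost e + icost e').+1
  end.

Fixpoint rcost (e : rexp) : nat :=
  match e with
  | RZero => 1
  | RGet _ e => (icost e).+1
  | RAdd e e' | RSub e e' => (rcost e + rcost e').+1
  end.

Fixpoint bcost (e : bexp) : nat :=
  match e with
  | BLeI e e' => (icost e + icost e').+1
  | BLeR e e' => (rcost e + rcost e').+1
  | BNot e => (bcost e).+1
  | BAnd e e' => (bcost e + bcost e').+1
  end.

(* [exec c m m' t]: run from memory m, the program c halts in memory m' after *)
(* t operations. Execution is deterministic.                                  *)
Inductive exec : cmd -> memory -> memory -> nat -> Prop :=
| exec_skip m : exec CSkip m m 1
| exec_seti a e e' m :
    exec (CSetI a e e') m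
         (Memory (update (imem m) a (ieval m e) (ieval m e')) (rmem m))
         (icost e + icost e').+1
| exec_setr a e e' m :
    exec (CSetR a e e') m
         (Memory (imem m) (update (rmem m) a (ieval m e) (reval m e')))
         (icost e + rcost e').+1
| exec_seq c1 c2 m1 m2 m3 t1 t2 :
    exec c1 m1 m2 t1 -> exec c2 m2 m3 t2 ->
    exec (CSeq c1 c2) m1 m3 (t1 + t2).+1
| exec_if_true e c1 c2 m m' t :
    beval m e -> exec c1 m m' t ->
    exec (CIf e c1 c2) m m' (bcost e + t).+1
| exec_if_false e c1 c2 m m' t :
    ~~ beval m e -> exec c2 m m' t ->
    exec (CIf e c1 c2) m m' (bcost e + t).+1
| exec_while_stop e c m :
    ~~ beval m e -> exec (CWhile e c) m m (bcost e).+1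
| exec_while_step e c m1 m2 m3 t1 t2 :
    beval m1 e -> exec c m1 m2 t1 -> exec (CWhile e c) m2 m3 t2 ->
    exec (CWhile e c) m1 m3 (bcost e + t1 + t2).+1.

(* The input: n in cell 0 of index array 0, the processing times on M1 and M2 *)
(* in the first n cells of real arrays 0 and 1.                               *)
Definition input_memory (n : nat) (I : flowshop R n) : memory :=
  {| imem := fun a i => if (a == 0) && (i == 0) then n else 0%N;
     rmem := fun a i => match insub i : option 'I_n with
                        | Some j => if a == 0 then p1 I j
                                    else if a == 1 then p2 I j else 0
                        | None => 0
                        end |}.

(* The output: the first n cells of index array 1. *)
Definition outputs (n : nat) (m : memory) (s : seq 'I_n) : Prop :=
  map val s = mkseq (imem m 1) n.

End Semantics.

(* Main.v *)
Require Import Defs.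
From mathcomp Require Import all_boot all_order all_algebra perm.
From mathcomp Require Import reals exp.
From mathcomp Require Import lra zify.
Import Order.TTheory GRing.Theory Num.Theory.
Local Open Scope ring_scope.

(** The makespan of a permutation schedule is the largest path value
    p1(s_1) + ... + p1(s_k) + p2(s_k) + ... + p2(s_n) over the positions k of
    its sequence s ([release2_le]). Let s list A, then a part of B, then a set
    T of jobs of B with the smallest p2, by nonincreasing p2. If k is in A,
    replacing p1 by the larger p2 before k bounds the path by P2 + pmaxA1, which
    is at most P1. If k is in the middle part, replacing p2 by the larger p1
    between k and T, and using that T gains at least pmaxB2, which pays for
    p2(k), bounds it by P1 again. Every schedule needs time P1
    ([makespan_ge_total1]). If k is in T, the path is a path of a Johnson
    sequence, and every schedule has at least that makespan
    ([makespan_ge_suffix]). So the order inside A and inside the middle part is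
    irrelevant ([split_optimal]).

    For the algorithm, it suffices to take the jobs of B one by one by
    increasing p2 until the gain, that is the sum of p1 - p2 over the jobs
    taken, reaches pmaxB2. The jobs from k_B on are exactly those of B with p2
    at most p2(k_B) ([johnson_tail]), so this stops after at most
    M = n - k_B + 1 jobs, indices counted from 1 ([johnson_suffix_short]). The
    minima come from a tournament tree on the n jobs, built by n - 1 comparisons
    and repaired along one path from a leaf to the root after each removal. The
    total time is O(n + M log n), and M log M <= n makes M log n linear in n
    ([extractions_linear]): either M * M <= n, and log n is O(sqrt n), or
    log n < 2 log M. *)

Set Implicit Arguments.
Unset Strict Implicit.
Unset Printing Implicit Defensive.

(** * Lower bounds on the makespan of a schedule *)

(** Induction on the number of jobs, removing a job j that starts last: the
    others must end before j starts, unless p j = 0, when j takes no room. *)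
Lemma packing (R : realType) (n : nat) (p S : 'I_n -> R) (a b : R)
    (X : {set 'I_n}) :
  one_at_a_time p S -> a <= b ->
  {in X, forall i, [/\ 0 <= p i, a <= S i & S i + p i <= b]} ->
  \sum_(i in X) p i <= b - a.
Proof.
move=> oneS; have [k] := ubnP #|X|; elim: k X b => // k IHk X b ltX ab inX.
have [-> | [x xX]] := set_0Vmem X; first by rewrite big_set0 subr_ge0.
have [j /= jX jmax] := arg_maxP S xX; have {}jX : j \in X by [].
have [pj0 aj jb] := inX j jX.
have ltXj : (#|X :\ j| < k)%N by rewrite (cardsD1 j) jX in ltX.
rewrite (big_setD1 j) //=; have [pj_gt0 | pj_le0] := ltP 0 (p j).
  suff : \sum_(i in X :\ j) p i <= S j - a by lra.
  apply: IHk => // i; rewrite in_setD1 => /andP[ij iX].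
  have [pi0 ai ib] := inX i iX; have := jmax i iX.
  by case: (oneS i j ij) => // ? ?; split=> //; lra.
suff : \sum_(i in X :\ j) p i <= b - a by lra.
by apply: IHk => // i; rewrite in_setD1 => /andP[_]; apply: inX.
Qed.

Lemma completion_le_makespan (R : realType) (n : nat) (I : flowshop R n)
    (S : schedule R n) (j : 'I_n) :
  start2 S j + p2 I j <= makespan I S.
Proof. exact: (le_bigmax 0 (fun i => start2 S i + p2 I i) j). Qed.

Lemma makespan_ge_total1 (R : realType) (n : nat) (I : flowshop R n)
    (S : schedule R n) :
  feasible I S -> total1 I <= makespan I S.
Proof.
case=> S0 S12 one1 _; rewrite -[makespan I S]subr0.
have := @packing _ _ _ _ 0 (makespan I S) setT one1.
rewrite (eq_bigl xpredT) => [|i]; last by rewrite inE.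
apply; first exact: bigmax_ge_id.
move=> i _; split=> //; first exact: p1_ge0.
have := completion_le_makespan I S i; have := S12 i; have := p2_ge0 I i; lra.
Qed.

(** The set U stands for the jobs that follow k in a Johnson sequence. Among
    the jobs outside U with p2 at least p2(k), let j be the one that leaves the
    first machine last. The jobs processed before j on the first machine fill
    its time up to the start of j, and the other jobs, with j, need the second
    machine after the completion of j. Comparing job by job, each job other than
    j contributes at least its term in the sum, while j contributes
    p1(j) + p2(j), hence at least p1(j) + p2(k). *)
Lemma makespan_ge_suffix (R : realType) (n : nat) (I : flowshop R n)
    (U : {pred 'I_n}) (k : 'I_n) (S : schedule R n) :
  k \notin U ->
  (forall i, i \in U -> p2 I i <= p1 I i) ->
  (forall i, i \notin U -> p1 I i <= p2 I i \/ p2 I k <= p2 I i) ->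
  feasible I S ->
  p2 I k + \sum_i (if i \in U then p2 I i else p1 I i) <= makespan I S.
Proof.
move=> kU leU leH [S0 S12 one1 one2].
(* C is the completion time on the first machine. *)
pose C i := start1 S i + p1 I i.
have Hk : (k \notin U) && (p2 I k <= p2 I k) by rewrite kU /=.
have [j /andP[jU kj] jmax] :=
  arg_maxP (P := fun i => (i \notin U) && (p2 I k <= p2 I i)) C Hk.
pose before i := start1 S i + p1 I i <= start1 S j.
have after i : i != j -> ~~ before i -> C j <= start1 S i.
  by move=> ij; rewrite /before; case: (one1 i j ij) => [-> | ].
pose g i := if (i != j) && before i then p1 I i else p2 I i.
have sum_before : \sum_(i | (i != j) && before i) p1 I i <= start1 S j - 0.
  rewrite (eq_bigl (mem [set i | (i != j) && before i])) => [|i]; last first.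
    by rewrite !inE.
  apply: packing (one1) _ _ => // i; rewrite inE => /andP[_ bi].
  by split=> //; exact: p1_ge0.
have sum_after : \sum_(i | ~~ ((i != j) && before i)) p2 I i
                   <= makespan I S - C j.
  rewrite (eq_bigl (mem [set i | ~~ ((i != j) && before i)])) => [|i].
    apply: packing (one2) _ _ => [|i].
      have := completion_le_makespan I S j; have := S12 j.
      by have := p2_ge0 I j; rewrite /C; lra.
    rewrite inE negb_and negbK => nbi; split; first exact: p2_ge0.
      have := S12 i; have [-> // | ij] := eqVneq i j.
      have := after i ij; rewrite (negPf ij) /= in nbi => /(_ nbi).
      by have := p1_ge0 I i; lra.
    exact: completion_le_makespan.
  by rewrite !inE.
have : \sum_i g i <= makespan I S - p1 I j.
  rewrite (bigID (fun i => (i != j) && before i)) /=.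
  rewrite (eq_bigr (p1 I)) => [|i bi]; last by rewrite /g bi.
  rewrite [X in _ + X](eq_bigr (p2 I)) => [|i /negPf bi]; last by rewrite /g bi.
  by rewrite /C in sum_after; lra.
have -> : \sum_i g i = p2 I j + \sum_(i | i != j) g i.
  by rewrite (bigD1 j) //= {1}/g eqxx.
have -> : \sum_i (if i \in U then p2 I i else p1 I i) =
          p1 I j + \sum_(i | i != j) (if i \in U then p2 I i else p1 I i).
  by rewrite (bigD1 j) //= ifN.
have : \sum_(i | i != j) (if i \in U then p2 I i else p1 I i)
         <= \sum_(i | i != j) g i; last by lra.
apply: ler_sum => i ij; rewrite /g ij /=.
case: ifP => iU; case: ifP => // bi; first exact: leU.
have [// | ki] := leH i (negbT iU).
(* By the choice of j, a job of this kind after j has p1 = 0. *)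
have := jmax i; rewrite /= iU ki /= => /(_ isT).
by have := after i ij (negbT bi); have := p2_ge0 I i; rewrite /C /=; lra.
Qed.

(** * Makespan of a permutation schedule *)

Lemma release1 (R : realType) (n : nat) (I : flowshop R n) (s : seq 'I_n) :
  (release I s).1 = \sum_(i <- s) p1 I i.
Proof.
elim/last_ind: s => [|s j IHs]; first by rewrite big_nil.
by rewrite /release foldl_rcons big_rcons /= -IHs.
Qed.

Lemma release2_rcons (R : realType) (n : nat) (I : flowshop R n)
    (s : seq 'I_n) (j : 'I_n) :
  (release I (rcons s j)).2 =
    Num.max (release I s).2 ((release I s).1 + p1 I j) + p2 I j.
Proof. by rewrite /release foldl_rcons. Qed.

Lemma release_cat_mono (R : realType) (n : nat) (I : flowshop R n)
    (s s' : seq 'I_n) :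
  (release I s).1 <= (release I (s ++ s')).1 /\
  (release I s).2 <= (release I (s ++ s')).2.
Proof.
elim/last_ind: s' => [|s' j [IH1 IH2]]; first by rewrite cats0.
rewrite -rcons_cat release2_rcons !release1 in IH1 *; split.
  by rewrite big_rcons /=; have := p1_ge0 I j; lra.
apply: (le_trans IH2); have := p2_ge0 I j.
set x := (release I (s ++ s')).2; set y := _ + p1 I j.
have : x <= Num.max x y by rewrite le_max lexx.
lra.
Qed.

(** The completion time of a sequence is its longest path, where a path runs on
    the first machine up to some job k and on the second one from k on. The
    first hypothesis covers the case of a path that never leaves the second
    machine. *)
Lemma release2_le (R : realType) (n : nat) (I : flowshop R n) (V : R)
    (s : seq 'I_n) :
  \sum_(i <- s) p2 I i <= V ->
  (forall s1 k s2, s = s1 ++ k :: s2 ->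
     \sum_(i <- s1) p1 I i + p1 I k + (p2 I k + \sum_(i <- s2) p2 I i) <= V) ->
  (release I s).2 <= V.
Proof.
elim/last_ind: s V => [|s j IHs] V; first by rewrite big_nil.
rewrite big_rcons /= release2_rcons => sumV critV.
have leV : Num.max (release I s).2 ((release I s).1 + p1 I j) <= V - p2 I j.
  rewrite ge_max; apply/andP; split.
    apply: IHs => [|s1 k s2 def_s]; first by lra.
    have := critV s1 k (rcons s2 j); rewrite def_s -rcons_cons -rcons_cat.
    by rewrite big_rcons /= => /(_ erefl); lra.
  have := critV s j [::]; rewrite cats1 big_nil release1 => /(_ erefl); lra.
by lra.
Qed.

Lemma take_index_lt (T : eqType) (s : seq T) (i j : T) :
  i \in s -> (index i s < index j s)%N ->
  exists s', take (index j s) s = rcons (take (index i s) s) i ++ s'.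
Proof.
move=> si ij; exists (drop (index i s).+1 (take (index j s) s)).
rewrite -{1}(cat_take_drop (index i s).+1 (take (index j s) s)); congr (_ ++ _).
rewrite take_takel // (take_nth i) ?index_mem // nth_index //.
Qed.

Lemma perm_schedule_feasible (R : realType) (n : nat) (I : flowshop R n)
    (s : seq 'I_n) :
  job_sequence s -> feasible I (perm_schedule I s).
Proof.
move=> job_s.
have in_s i : i \in s by rewrite (perm_mem job_s) mem_enum.
have index_neq i j : i != j -> index i s != index j s.
  apply: contraNneq => eq_ij.
  by rewrite -(nth_index i (in_s i)) eq_ij nth_index.
have order i j : (index i s < index j s)%N ->
    [/\ start1 (perm_schedule I s) i + p1 I i <= start1 (perm_schedule I s) j
      & start2 (perm_schedule I s) i + p2 I i <= start2 (perm_schedule I s) j].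
  move=> /(take_index_lt (in_s i)) [s' /= ->].
  set r := take _ s; have [] := release_cat_mono I (rcons r i) s'.
  rewrite release2_rcons !release1 big_rcons /= => le1 le2; split; first by lra.
  by rewrite le_max le2.
split=> [j|j|i j ij|i j ij] /=.
- by rewrite release1; apply: sumr_ge0 => i _; apply: p1_ge0.
- by rewrite le_max lexx orbT.
- by have := index_neq i j ij; case: ltngtP => // ltij _;
    have [? ?] := order _ _ ltij; [left | right].
by have := index_neq i j ij; case: ltngtP => // ltij _;
  have [? ?] := order _ _ ltij; [left | right].
Qed.

Lemma makespan_perm_schedule (R : realType) (n : nat) (I : flowshop R n)
    (s : seq 'I_n) :
  job_sequence s -> makespan I (perm_schedule I s) <= (release I s).2.
Proof.
move=> job_s; apply: bigmax_le => [|j _ /=].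
  by have [_] := release_cat_mono I [::] s.
have js : j \in s by rewrite (perm_mem job_s) mem_enum.
have := release2_rcons I (take (index j s) s) j => <-.
rewrite -{1}[j in rcons _ j](nth_index j js) -take_nth ?index_mem //.
by rewrite -[X in _ <= (release I X).2](cat_take_drop (index j s).+1);
  have [] := release_cat_mono I (take (index j s).+1 s) (drop (index j s).+1 s).
Qed.

Lemma cons_cat_split (T : Type) (s1 s2 a b : seq T) (k : T) :
  a ++ b = s1 ++ k :: s2 ->
  (exists2 c, a = s1 ++ k :: c & s2 = c ++ b) \/
  (exists2 c, s1 = a ++ c & b = c ++ k :: s2).
Proof.
elim: a s1 => [|x a IHa] [|y s1] //=.
- by move=> ->; right; exists [::].
- by move=> ->; right; exists (y :: s1).
- by case=> -> <-; left; exists a.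
case=> -> /IHa [[c -> ->] | [c -> ->]]; first by left; exists c.
by right; exists c.
Qed.

(** * Optimality of a partially sorted sequence *)

Lemma mem_filter_enum (n : nat) (P : pred 'I_n) (i : 'I_n) :
  (i \in [seq j <- enum 'I_n | P j]) = P i.
Proof. by rewrite mem_filter mem_enum andbT. Qed.

Lemma uniq_filter_enum (n : nat) (P : pred 'I_n) :
  uniq [seq j <- enum 'I_n | P j].
Proof. by rewrite filter_uniq // enum_uniq. Qed.

Lemma jobsAE (R : realType) (n : nat) (I : flowshop R n) (i : 'I_n) :
  (i \in jobsA I) = (i \notin jobsB I).
Proof. by rewrite !inE -leNgt. Qed.

Lemma p2_lt_total1 (R : realType) (n : nat) (I : flowshop R n) (j : 'I_n) :
  j \in jobsB I -> p2 I j < total1 I.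
Proof.
rewrite inE => jB; apply: lt_le_trans jB _; rewrite /total1 (bigD1 j) //= lerDl.
by apply: sumr_ge0 => i _; apply: p1_ge0.
Qed.

(** The critical job is in sA, in sM or in sT. The tail sT may cut through a
    group of jobs with equal p2, and beta may be any upper bound of p2 on B: the
    tail and the bound found by the program are of this kind. *)
Lemma split_optimal (R : realType) (n : nat) (I : flowshop R n) (beta : R)
    (sA sM sT : seq 'I_n) :
  job_sequence (sA ++ sM ++ sT) ->
  {subset sA <= jobsA I} -> {subset sM ++ sT <= jobsB I} ->
  {in sM & sT, forall i j, p2 I j <= p2 I i} ->
  sorted (fun i j => p2 I j <= p2 I i) sT ->
  total2 I <= total1 I - pmaxA1 I ->
  {in jobsB I, forall i, p2 I i <= beta} ->
  \sum_(i <- sT) p2 I i <= \sum_(i <- sT) p1 I i - beta ->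
  optimal I (perm_schedule I (sA ++ sM ++ sT)).
Proof.
move=> job_s sA_A sMT_B leMT sortT P2P1 le_beta sumT.
split=> [|S feasS]; first exact: perm_schedule_feasible.
apply: le_trans (makespan_perm_schedule I job_s) _.
have geP1 := makespan_ge_total1 feasS.
have uniq_s : uniq (sA ++ sM ++ sT) by rewrite (perm_uniq job_s) enum_uniq.
have sum_s (F : 'I_n -> R) : \sum_i F i = \sum_(i <- sA ++ sM ++ sT) F i.
  by rewrite (perm_big _ job_s) big_enum.
have pA i : i \in sA -> p1 I i <= p2 I i by move/sA_A; rewrite inE.
have pB i : i \in sM ++ sT -> p2 I i <= p1 I i.
  by move/sMT_B; rewrite inE => /ltW.
have pmaxA_ge0 : 0 <= pmaxA1 I by apply: bigmax_ge_id.
have sub_sum1 (r : seq 'I_n) (F G : 'I_n -> R) :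
    {in r, forall i, F i <= G i} -> \sum_(i <- r) F i <= \sum_(i <- r) G i.
  by move=> FG; rewrite big_seq [leRHS]big_seq; apply: ler_sum => i /FG.
have P1E := sum_s (p1 I); have P2E := sum_s (p2 I).
rewrite -/(total1 I) in P1E; rewrite -/(total2 I) in P2E.
apply: release2_le => [|s1 k s2 def_s]; first by rewrite -P2E; lra.
case: (cons_cat_split def_s) => [[c defA defs2] | [c defs1]].
  (* k is in A: the path is at most P2 + pmaxA1. *)
  have le_c : \sum_(i <- s1) p1 I i <= \sum_(i <- s1) p2 I i.
    by apply: sub_sum1 => i is1; apply: pA; rewrite defA mem_cat is1.
  have le_k : p1 I k <= pmaxA1 I.
    apply: (le_bigmax_cond 0 (p1 I)); apply: sA_A.
    by rewrite defA mem_cat inE eqxx orbT.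
  rewrite def_s big_cat big_cons /= in P2E; lra.
move=> defMT; have [[d defM defs2] | [d defc defT]] := cons_cat_split defMT.
  (* k is in the middle part: the path is at most P1. *)
  have le_d : \sum_(i <- d) p2 I i <= \sum_(i <- d) p1 I i.
    apply: sub_sum1 => i id; apply: pB.
    by rewrite defM !mem_cat inE id !orbT.
  have le_k : p2 I k <= beta.
    by apply/le_beta/sMT_B; rewrite defM !mem_cat inE eqxx !orbT.
  rewrite def_s defs2 !(big_cat, big_cons) /= in P1E *; lra.
(* k is in the sorted tail: the path is a lower bound for every schedule. *)
have disj i : i \in s2 -> i \notin s1 ++ [:: k].
  move: uniq_s; rewrite def_s -cat1s catA cat_uniq => /and3P[_ /hasPn h _].
  exact: h.
have <- : p2 I k + \sum_i (if i \in s2 then p2 I i else p1 I i) =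
   \sum_(i <- s1) p1 I i + p1 I k + (p2 I k + \sum_(i <- s2) p2 I i).
  rewrite sum_s def_s -cat1s catA big_cat big_cat big_seq1 /=.
  have ks1 : k \in s1 ++ [:: k] by rewrite mem_cat inE eqxx orbT.
  have -> : (k \in s2) = false by apply/negP => /disj; rewrite ks1.
  rewrite (eq_big_seq (p1 I)) => [|i is1].
    rewrite [X in _ + (_ + X)](eq_big_seq (p2 I)) => [|i ->]; [lra | by []].
  by case: ifP => // /disj; rewrite mem_cat is1.
have geT : {in d, forall i, p2 I k <= p2 I i}.
  have trans : transitive (fun i j => p2 I j <= p2 I i).
    by move=> y x z /= xy yz; apply: le_trans yz xy.
  move: sortT; rewrite defT (sorted_pairwise trans) pairwise_cat /=.
  by case/and3P=> /allrelP dk _ _ i id; apply: dk; rewrite ?inE ?eqxx.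
apply: makespan_ge_suffix feasS => [|i is2|i is2].
- by apply/negP => /disj; rewrite mem_cat inE eqxx orbT.
- by apply: pB; rewrite defMT mem_cat inE is2 !orbT.
have : i \in sA ++ sM ++ sT by rewrite (perm_mem job_s) mem_enum.
rewrite !mem_cat => /or3P[/pA | iM | ]; [by left | right | ].
  by apply: leMT; rewrite // defT mem_cat inE eqxx orbT.
rewrite defT mem_cat inE (negPf is2) orbF => /orP[/geT | /eqP->]; by right.
Qed.

(** * Johnson's indexing *)

(** Since p2(k) < p2(k - 1), no job of B before k has the same p2 as k; so the
    tail from k can be described without the indexing. *)
Lemma johnson_tail (R : realType) (n : nat) (I : flowshop R n) (k i : 'I_n) :
  johnson_indexed I -> kB_condition I k ->
  (k <= i)%N = (i \in jobsB I) && (p2 I i <= p2 I k).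
Proof.
case=> AE _ decB [kB _ k_first].
have BE j : (j \in jobsB I) = (nA I <= j)%N.
  by rewrite leqNgt -AE !inE -ltNge.
have [ki | ik] := leqP k i.
  have iB : i \in jobsB I by rewrite !BE in kB *; apply: leq_trans ki.
  by rewrite iB decB.
apply/esym/negbTE/negP => /andP[iB le_ik].
have k1_lt : (k.-1 < n)%N by apply: leq_ltn_trans (ltn_ord k); apply: leq_pred.
pose j := Ordinal k1_lt.
have jk : j.+1 = k by rewrite /= prednK // (leq_ltn_trans _ ik).
have ij : (i <= j)%N by rewrite -ltnS jk.
have jB : (nA I <= j)%N by rewrite BE in iB; apply: leq_trans ij.
have := decB i j iB; rewrite BE => /(_ jB ij).
by have := k_first j jB jk; lra.
Qed.

Lemma johnson_order_optimal (R : realType) (n : nat) (I : flowshop R n)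
    (k : 'I_n) (sA sM : seq 'I_n) :
  johnson_indexed I -> total2 I <= total1 I - pmaxA1 I -> kB_condition I k ->
  perm_eq sA [seq j : 'I_n <- enum 'I_n | (j < nA I)%N] ->
  perm_eq sM [seq j : 'I_n <- enum 'I_n | (nA I <= j < k)%N] ->
  let s := sA ++ sM ++ [seq j : 'I_n <- enum 'I_n | (k <= j)%N] in
  job_sequence s /\ optimal I (perm_schedule I s).
Proof.
move=> jI P2P1 condk permA permM.
have tailE i := johnson_tail i jI condk.
have [AE _ decB] := jI; have [kB sumk _] := condk.
have BE j : (j \in jobsB I) = (nA I <= j)%N.
  by rewrite leqNgt -AE !inE -ltNge.
have nAk : (nA I <= k)%N by rewrite -BE.
set sT := [seq j : 'I_n <- _ | (k <= j)%N] => s.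
have job_s : job_sequence s.
  rewrite /job_sequence (perm_catl _ (perm_cat permM (perm_refl sT))).
  rewrite (perm_catr _ permA) uniq_perm ?enum_uniq //.
    rewrite !cat_uniq !uniq_filter_enum andbT /=.
    apply/andP; split; apply/hasPn => i; rewrite ?mem_cat !mem_filter_enum; lia.
  by move=> i; rewrite !mem_cat !mem_filter_enum mem_enum inE; lia.
split=> //; apply: (split_optimal (beta := pmaxB2 I)) => //.
- by move=> i; rewrite (perm_mem permA) mem_filter_enum AE.
- by move=> i; rewrite mem_cat (perm_mem permM) !mem_filter_enum BE; lia.
- move=> i j; rewrite (perm_mem permM) !mem_filter_enum.
  move=> /andP[iB ik] kj.
  by apply: decB; rewrite ?BE //; lia.
- have : sorted ltn (map val sT).
    apply: (subseq_sorted ltn_trans) (iota_ltn_sorted 0 n).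
    by rewrite -val_enum_ord map_subseq // filter_subseq.
  rewrite sorted_map.
  have : all (fun j : 'I_n => k <= j)%N sT by apply: filter_all.
  apply: sub_in_sorted => i j; rewrite -!topredE /= => ki kj /ltnW.
  by apply: decB; rewrite BE; [apply: leq_trans ki | apply: leq_trans kj].
- by move=> i iB; apply: (le_bigmax_cond 0 (p2 I)).
rewrite /sT !big_filter !big_enum_cond /=.
by rewrite !(eq_bigl _ _ tailE).
Qed.

(** Carries the hypotheses on k, which refer to Johnson's indexing, over to the
    unsorted input: only the threshold p2 (sigma k) and the number of jobs below
    it survive. *)
Lemma relabel_tail (R : realType) (n : nat) (I : flowshop R n) (sigma : 'S_n)
    (k : 'I_n) (T := [set i in jobsB I | p2 I i <= p2 I (sigma k)]) :
  johnson_indexed (relabel I sigma) -> kB_condition (relabel I sigma) k ->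
  #|T| = (n - k)%N /\
  \sum_(i in T) p2 I i <= \sum_(i in T) p1 I i - pmaxB2 I.
Proof.
move=> jI condk; have tailE i := johnson_tail i jI condk.
have memB i : (i \in jobsB (relabel I sigma)) = (sigma i \in jobsB I).
  by rewrite !inE.
split.
  rewrite -(card_preimset _ (@perm_inj _ sigma)).
  transitivity #|[set i : 'I_n | (k <= i)%N]|.
    by apply: eq_card => i; rewrite inE [RHS]inE tailE memB [in LHS]inE.
  rewrite -sum1_card (eq_bigl (fun i : 'I_n => true && (k <= i)%N)) => [|i].
    by rewrite -(big_geq_mkord k n xpredT (fun=> 1%N)) sum_nat_const_nat muln1.
  by rewrite inE.
have -> : pmaxB2 I = pmaxB2 (relabel I sigma).
  rewrite /pmaxB2 (reindex_inj (@perm_inj _ sigma)).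
  by apply: eq_bigl => i; rewrite memB.
have sumT (F : 'I_n -> R) : \sum_(i in T) F i =
    \sum_(i in jobsB (relabel I sigma) | p2 I (sigma i) <= p2 I (sigma k))
      F (sigma i).
  rewrite (reindex_inj (@perm_inj _ sigma)).
  by apply: eq_bigl => i; rewrite inE memB.
by have [_ ] := condk; rewrite !sumT.
Qed.

(** * Suffixes of Johnson sequences *)

Section Greedy.
Variables (R : realType) (n : nat) (I : flowshop R n).

Definition gain (X : seq 'I_n) : R := \sum_(i <- X) (p1 I i - p2 I i).

(** X can end a Johnson sequence: ties being broken suitably, its jobs are the
    last ones of B, in Johnson's order. *)
Definition johnson_suffix (X : seq 'I_n) : Prop :=
  [/\ uniq X, {subset X <= jobsB I},
      sorted (fun i j => p2 I j <= p2 I i) X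
    & forall i j, i \in X -> j \in jobsB I -> j \notin X -> p2 I i <= p2 I j].

Lemma johnson_suffix_cons (X : seq 'I_n) (w : 'I_n) :
  johnson_suffix X -> w \in jobsB I -> w \notin X ->
  (forall j, j \in jobsB I -> j \notin X -> p2 I w <= p2 I j) ->
  johnson_suffix (w :: X).
Proof.
case=> uX XB sX minX wB wX minw; split.
- by rewrite /= wX.
- by move=> i; rewrite inE => /predU1P[-> | /XB].
- case: X sX minX {uX XB minw} wX => //= x X -> minX wX.
  by rewrite andbT; apply: minX; rewrite ?mem_head.
move=> i j; rewrite !in_cons negb_or => /predU1P[-> | iX] jB /andP[_ jX].
  exact: minw.
exact: minX.
Qed.

(** If X contained T, its gain would be at least that of T, since each job of B
    has a positive gain. So some y of T is not in X, and then no job of X has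
    p2 above q: X is a proper subset of T. *)
Lemma johnson_suffix_short (X : seq 'I_n) (q : R)
    (T := [set i in jobsB I | p2 I i <= q]) :
  \sum_(i in T) p2 I i <= \sum_(i in T) p1 I i - pmaxB2 I ->
  johnson_suffix X -> gain X < pmaxB2 I ->
  (size X < #|T|)%N /\ exists2 y, y \in jobsB I & y \notin X.
Proof.
move=> sumT [uX XB _ minX] gainX.
have gain_ge0 i : i \in X -> 0 <= p1 I i - p2 I i.
  by move/XB; rewrite inE; lra.
have [TX | /subsetPn[y]] := boolP (T \subset X).
  suff : \sum_(i in T) (p1 I i - p2 I i) <= gain X.
    by rewrite big_split sumrN /=; lra.
  rewrite /gain (big_uniq _ uX) [leRHS](bigID (mem T)) /=.
  rewrite (eq_bigl (fun i => (i \in X) && (i \in T))) => [|i].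
    by rewrite lerDl; apply: sumr_ge0 => i /andP[/gain_ge0].
  by rewrite andb_idl //; apply: (subsetP TX).
rewrite inE => /andP[yB yq] yX; split; last by exists y.
have XT : {subset X <= T}.
  by move=> i iX; rewrite inE (XB i iX) (le_trans (minX i y _ _ _) yq).
have : {subset y :: X <= enum T}.
  by move=> i; rewrite inE mem_enum => /predU1P[-> | /XT //]; rewrite inE yB.
by move/uniq_leq_size; rewrite /= yX uX -cardE => /(_ isT).
Qed.

Lemma johnson_suffix_optimal (X : seq 'I_n) (beta : R)
    (s := [seq j <- enum 'I_n | j \in jobsA I] ++
          [seq j <- enum 'I_n | (j \in jobsB I) && (j \notin X)] ++ X) :
  total2 I <= total1 I - pmaxA1 I -> {in jobsB I, forall i, p2 I i <= beta} ->
  johnson_suffix X -> beta <= gain X ->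
  job_sequence s /\ optimal I (perm_schedule I s).
Proof.
move=> P2P1 le_beta [uX XB sX minX] gainX.
have job_s : job_sequence s.
  rewrite /job_sequence uniq_perm ?enum_uniq //.
    rewrite !cat_uniq !uniq_filter_enum uX andbT /=.
    apply/andP; split; apply/hasPn => i.
      rewrite mem_cat !mem_filter_enum jobsAE negbK.
      by case/orP=> [/andP[] // | ]; exact: XB.
    by move=> iX; rewrite mem_filter_enum iX andbF.
  move=> i; rewrite !mem_cat !mem_filter_enum mem_enum jobsAE [RHS]inE.
  by case: (i \in jobsB I) => //=; case: (i \in X).
split=> //; apply: (split_optimal (beta := beta)) => //.
- by move=> i; rewrite mem_filter_enum.
- by move=> i; rewrite mem_cat mem_filter_enum => /orP[/andP[] | /XB].
- by move=> i j; rewrite mem_filter_enum => /andP[iB iX] jX; apply: minX.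
by move: gainX; rewrite /gain big_split sumrN /=; lra.
Qed.
End Greedy.

(** * Tournament trees *)

(** A tournament tree on the jobs 0, ..., n - 1 is stored in an array t: node v
    has the children 2v and 2v + 1, the root is 1 and job j sits at the leaf
    n + j. This works for every n >= 1, powers of 2 or not. *)
Definition winner (R : realType) (key : nat -> R) (a b : nat) : nat :=
  if key a <= key b then a else b.

Lemma winner_le (R : realType) (key : nat -> R) (a b : nat) :
  key (winner key a b) <= key a /\ key (winner key a b) <= key b.
Proof. by rewrite /winner; have [ab|/ltW ab] := leP (key a) (key b); split. Qed.

(** Node v is u or an ancestor of u. *)
Definition above (v u : nat) : Prop := exists k, iter k half u = v.

(** The job recorded at a node comes from a leaf below that node. Hence changing
    the key of job w can only falsify matches on the path from its leaf. *)
Definition seeded (n : nat) (t : nat -> nat) : Prop :=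
  (forall j, (j < n)%N -> t (n + j)%N = j) /\
  (forall v, (0 < v < n.*2)%N -> (t v < n)%N /\ above v (n + t v)).

Definition played (R : realType) (key : nat -> R) (t : nat -> nat) (v : nat) :=
  t v = winner key (t v.*2) (t v.*2.+1).

(** Every match is correct, except possibly at the proper ancestors of i. For
    i = 1 there is no such ancestor, since only 0 is above 1./2 = 0. *)
Definition up_to_date (R : realType) (n : nat) (key : nat -> R)
    (t : nat -> nat) (i : nat) : Prop :=
  forall v, (0 < v < n)%N -> ~ above v i./2 -> played key t v.

Definition set_node (t : nat -> nat) (v x : nat) : nat -> nat :=
  fun u => if u == v then x else t u.

Lemma above_half v u : above v.*2 u \/ above v.*2.+1 u -> above v u./2.
Proof.
by case=> [[k iterk]|[k iterk]]; exists k;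
  rewrite -iterSr iterS iterk /= ?uphalf_double ?doubleK.
Qed.

(** Going up from u to u./2, the key of the recorded job can only decrease. *)
Lemma champion_min (R : realType) (n : nat) (key : nat -> R) t j :
  seeded n t -> up_to_date n key t 1 -> (j < n)%N -> key (t 1%N) <= key j.
Proof.
move=> [leaf _] upd jn; rewrite -[in leRHS](leaf j jn).
have : (0 < n + j < n.*2)%N by lia.
move: {j jn leaf} (n + j)%N => u; have [k] := ubnP u.
elim: k u => // k IHk u ltuk u_n; have [u1 | u_gt1] := leqP u 1.
  by have -> : u = 1%N by lia.
have h_n : (0 < u./2 < n)%N by lia.
apply: (le_trans (IHk u./2 _ _)); [lia | lia | ].
rewrite (upd _ h_n) => [|[l]]; last by rewrite iter_fix //; lia.
have := odd_double_half u; case: odd => def_u; rewrite -[in leRHS]def_u.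
  by rewrite add1n; have [] := winner_le key (t u./2.*2) (t u./2.*2.+1).
by rewrite add0n; have [] := winner_le key (t u./2.*2) (t u./2.*2.+1).
Qed.

Lemma winner_seeded (R : realType) (n : nat) (key : nat -> R) t v
    (x := winner key (t v.*2) (t v.*2.+1)) :
  (forall u, u = v.*2 \/ u = v.*2.+1 -> (t u < n)%N /\ above u (n + t u)) ->
  (x < n)%N /\ above v (n + x).
Proof.
move=> child; rewrite /x /winner; case: ifP => _.
  have [tn [k iterk]] := child v.*2 (or_introl erefl).
  by split=> //; exists k.+1; rewrite iterS iterk doubleK.
have [tn [k iterk]] := child v.*2.+1 (or_intror erefl).
by split=> //; exists k.+1; rewrite iterS iterk /= uphalf_double.
Qed.

Lemma up_to_date_change (R : realType) (n : nat) (key key' : nat -> R) t w :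
  seeded n t -> up_to_date n key t 1 ->
  (forall j, (j < n)%N -> j != w -> key' j = key j) ->
  up_to_date n key' t (n + w).
Proof.
move=> [_ anc] upd eq_key v vn nabove.
have child u : u = v.*2 \/ u = v.*2.+1 -> key' (t u) = key (t u).
  move=> def_u; have un : (0 < u < n.*2)%N by lia.
  have [tun tu] := anc u un; apply: eq_key => //; apply: contra_notN nabove.
  by move/eqP=> tw; apply: above_half; rewrite -tw; case: def_u => <-;
    [left | right].
rewrite /played /winner !child; [|by right|by left].
by apply: upd => // -[l]; rewrite iter_fix //; lia.
Qed.

(** The repair moves the frontier of stale matches one level up: the match at
    the parent v of i becomes correct, and rewriting node v only affects the
    matches above v. *)
Lemma replay (R : realType) (n : nat) (key : nat -> R) t i
    (v := i./2) (t' := set_node t v (winner key (t v.*2) (t v.*2.+1))) :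
  seeded n t -> up_to_date n key t i -> (1 < i < n.*2)%N ->
  seeded n t' /\ up_to_date n key t' v.
Proof.
move=> [leaf anc] upd i_n; have v_n : (0 < v < n)%N by rewrite /v; lia.
split; first split=> [j jn|u un].
- by rewrite /t' /set_node; case: eqP => [|_]; [lia | apply: leaf].
- rewrite /t' /set_node; case: eqP => [->|_]; last exact: anc.
  by apply: winner_seeded => w def_w; apply: anc; lia.
move=> u un nabove; rewrite /played /t' /set_node.
have [-> | uv] := eqVneq u v.
  by do 2![case: eqP => [|_]; first by lia].
have -> : (u.*2 == v) = false.
  by apply: contra_notF nabove => /eqP <-; exists 0%N; rewrite /= doubleK.
have -> : (u.*2.+1 == v) = false.
  by apply: contra_notF nabove => /eqP <-; exists 0%N; rewrite /= uphalf_double.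
apply: upd => // -[[|k] iterk]; first by rewrite -iterk eqxx in uv.
by apply: nabove; exists k; rewrite -iterSr.
Qed.

(** State of the construction when the nodes numbered more than i are done; i
    goes from n - 1 down to 0. *)
Definition seeded_from (R : realType) (n : nat) (key : nat -> R)
    (t : nat -> nat) (i : nat) : Prop :=
  [/\ forall j, (j < n)%N -> t (n + j)%N = j,
      forall v, (i < v < n.*2)%N -> (t v < n)%N /\ above v (n + t v)
    & forall v, (i < v < n)%N -> played key t v].

Lemma seeded_from_leaves (R : realType) (n : nat) (key : nat -> R) t :
  (forall j, (j < n)%N -> t (n + j)%N = j) -> seeded_from n key t n.-1.
Proof.
move=> leaf; split=> // v vn; last by lia.
have def_v : v = (n + (v - n))%N by lia.
have tv : t v = (v - n)%N by rewrite {1}def_v leaf; lia.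
by rewrite tv; split; [lia | exists 0%N; rewrite /= -def_v].
Qed.

Lemma seeded_from_step (R : realType) (n : nat) (key : nat -> R) t i
    (t' := set_node t i.+1 (winner key (t i.+1.*2) (t i.+1.*2.+1))) :
  (i.+1 < n)%N -> seeded_from n key t i.+1 -> seeded_from n key t' i.
Proof.
move=> i_n [leaf anc upd]; rewrite /t' /set_node; split=> [j jn|v vn|v vn].
- by case: eqP => [|_]; [lia | apply: leaf].
- case: eqP => [->|v_i]; last by apply: anc; lia.
  by apply: winner_seeded => w def_w; apply: anc; lia.
rewrite /played; have -> : (v.*2 == i.+1) = false by lia.
have -> : (v.*2.+1 == i.+1) = false by lia.
by have [-> // | v_i] := eqVneq v i.+1; apply: upd; lia.
Qed.

Lemma seeded_from0 (R : realType) (n : nat) (key : nat -> R) t :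
  seeded_from n key t 0 -> seeded n t /\ up_to_date n key t 1.
Proof. by case=> leaf anc upd; split=> // v vn _; apply: upd. Qed.

(** * Running time of programs *)

Section Machine.
Variable R : realType.
Implicit Type m : memory R.

(** Total correctness with a time bound. *)
Definition halts (c : cmd) m (T : nat) (Q : memory R -> Prop) : Prop :=
  exists m' t, [/\ exec c m m' t, (t <= T)%N & Q m'].

Lemma halts_weaken c m T T' (Q Q' : memory R -> Prop) :
  halts c m T Q -> (T <= T')%N -> (forall m', Q m' -> Q' m') -> halts c m T' Q'.
Proof.
move=> [m' [t [cm tT Qm']]] TT' QQ'; exists m', t; split=> //; last exact: QQ'.
exact: leq_trans TT'.
Qed.

Lemma halts_seq c1 c2 m T1 T2 (P Q : memory R -> Prop) :
  halts c1 m T1 P -> (forall m', P m' -> halts c2 m' T2 Q) ->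
  halts (CSeq c1 c2) m (T1 + T2).+1 Q.
Proof.
move=> [m1 [t1 [c1m t1T Pm1]]] /(_ m1 Pm1) [m2 [t2 [c2m t2T Qm2]]].
by exists m2, (t1 + t2).+1; split=> //; [apply: exec_seq c1m c2m | lia].
Qed.

(** The number k bounds the iterations that remain; the loop may stop
    earlier. *)
Lemma halts_while e c T (Inv : nat -> memory R -> Prop) :
  (forall k m, Inv k m -> beval m e ->
     (0 < k)%N /\ halts c m T (Inv k.-1)) ->
  forall k m, Inv k m ->
    halts (CWhile e c) m ((bcost e + T).+1 * k + (bcost e).+1)
      (fun m' => ~~ beval m' e /\ exists k', Inv k' m').
Proof.
move=> step k; elim: k => [|k IHk] m Im.
  have [em | nem] := boolP (beval m e); first by have [] := step _ _ Im em.
  exists m, (bcost e).+1; split; [exact: exec_while_stop | lia | ].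
  by split=> //; exists 0%N.
have [em | nem] := boolP (beval m e); last first.
  exists m, (bcost e).+1; split; [exact: exec_while_stop | lia | ].
  by split=> //; exists k.+1.
have [_ [m1 [t1 [cm t1T Im1]]]] := step _ _ Im em.
have [m2 [t2 [wm t2T Qm2]]] := IHk m1 Im1.
exists m2, (bcost e + t1 + t2).+1; split=> //; last by rewrite mulnS; lia.
exact: exec_while_step em cm wm.
Qed.

Fixpoint loop_free (c : cmd) : bool :=
  match c with
  | CSeq c1 c2 | CIf _ c1 c2 => loop_free c1 && loop_free c2
  | CWhile _ _ => false
  | _ => true
  end.

(** Meant for loop-free programs; the value on loops is arbitrary. *)
Fixpoint run (c : cmd) m : memory R :=
  match c with
  | CSkip | CWhile _ _ => m
  | CSetI a e e' =>
      Memory (update (imem m) a (ieval m e) (ieval m e')) (rmem m)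
  | CSetR a e e' =>
      Memory (imem m) (update (rmem m) a (ieval m e) (reval m e'))
  | CSeq c1 c2 => run c2 (run c1 m)
  | CIf e c1 c2 => if beval m e then run c1 m else run c2 m
  end.

(** Upper bound on the time of a loop-free program: both branches of a
    conditional are charged. *)
Fixpoint cost (c : cmd) : nat :=
  match c with
  | CSkip => 1
  | CSetI _ e e' => (icost e + icost e').+1
  | CSetR _ e e' => (icost e + rcost e').+1
  | CSeq c1 c2 => (cost c1 + cost c2).+1
  | CIf e c1 c2 => (bcost e + (cost c1 + cost c2)).+1
  | CWhile _ _ => 0
  end.

Lemma halts_run c m (Q : memory R -> Prop) :
  loop_free c -> Q (run c m) -> halts c m (cost c) Q.
Proof.
move=> lfc Qm.
suff [t [cm tT]] : exists t, exec c m (run c m) t /\ (t <= cost c)%N.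
  by exists (run c m), t.
elim: c m lfc {Q Qm} => [|a e e'|a e e'|c1 IH1 c2 IH2|e c1 IH1 c2 IH2|//] m /=.
- by exists 1%N; split=> //; apply: exec_skip.
- by move=> _; eexists; split; first exact: exec_seti.
- by move=> _; eexists; split; first exact: exec_setr.
- case/andP=> /(IH1 m) [t1 [cm1 t1T]] /(IH2 (run c1 m)) [t2 [cm2 t2T]].
  by exists (t1 + t2).+1; split; [apply: exec_seq cm1 cm2 | lia].
case/andP=> /(IH1 m) [t1 [cm1 t1T]] /(IH2 m) [t2 [cm2 t2T]].
case: ifPn => em.
  by exists (bcost e + t1).+1; split; [apply: exec_if_true | lia].
by exists (bcost e + t2).+1; split; [apply: exec_if_false | lia].
Qed.

End Machine.

(** Memory layout. Index arrays: 0 holds n, 1 the output, 2 the tournament tree,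
    3 the parents of its nodes (there is no division), and the scalars are 4 the
    current job or node, 5 and 6 the ends of the free zone of the output, 7 the
    extracted job. Real arrays: 0 and 1 hold p1 and p2, 2 the keys, and the
    scalars are 3 for P1, 4 for pmaxB2, 5 for the gain of the extracted jobs. *)
Definition var (a : nat) : iexp := IGet a (IConst 0).
Definition rvar (a : nat) : rexp := RGet a (IConst 0).

Definition for_jobs (c : cmd) : cmd :=
  CSeq (CSetI 4 (IConst 0) (IConst 0))
       (CWhile (BLeI (IAdd (var 4) (IConst 1)) (var 0))
               (CSeq c (CSetI 4 (IConst 0) (IAdd (var 4) (IConst 1))))).

(** The constant 20 covers the test, the increment and the initialization of
    the counter, each of which costs a few operations. *)
Lemma halts_for_jobs (R : realType) (n : nat) (c : cmd) (m : memory R)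
    (Inv : nat -> memory R -> Prop) :
  loop_free c ->
  (forall i m k, Inv i m -> Inv i (Memory (update (imem m) 4 0 k) (rmem m))) ->
  (forall i m, Inv i m -> imem m 0 0 = n) ->
  (forall i m, (i < n)%N -> imem m 4 0 = i -> Inv i m ->
     imem (run c m) 4 0 = i /\ Inv i.+1 (run c m)) ->
  Inv 0 m -> halts (for_jobs c) m ((cost c + 20) * n.+1) (Inv n).
Proof.
move=> lfc stable sizeE step Inv0.
set init := CSetI 4 (IConst 0) (IConst 0).
set body := CSeq c (CSetI 4 (IConst 0) (IAdd (var 4) (IConst 1))).
pose J k m := imem m 4 0 = (n - k)%N /\ (k <= n)%N /\ Inv (n - k)%N m.
have J0 : halts init m (cost init) (J n).
  apply: halts_run => //=; rewrite /J subnn; split=> //; split=> //.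
  exact: stable.
have Jstep k m' : J k m' ->
    beval m' (BLeI (IAdd (var 4) (IConst 1)) (var 0)) ->
    (0 < k)%N /\ halts body m' (cost body) (J k.-1).
  move=> [iE [kn Im]] /=; rewrite (sizeE _ _ Im) iE => lt_i.
  split; first by lia.
  have [|iE' Im'] := step _ m' _ iE Im; first by lia.
  apply: halts_run; first by rewrite /= lfc.
  rewrite /J; have <- : (n - k).+1 = (n - k.-1)%N by lia.
  rewrite /= /update /= iE' addn1; split=> //; split; first by lia.
  exact: stable.
apply: halts_weaken (halts_seq J0 (halts_while Jstep (k := n))) _ _.
  by rewrite /= !mulnDl !mulnS; lia.
move=> m' [nguard [k [iE [kn Im]]]].
have : (n - k)%N = n; last by move=> <-.
by move: nguard; rewrite /= iE (sizeE _ _ Im); lia.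
Qed.

(** * The program *)

Definition p1_at (e : iexp) : rexp := RGet 0 e.
Definition p2_at (e : iexp) : rexp := RGet 1 e.
Definition in_A (e : iexp) : bexp := BLeR (p1_at e) (p2_at e).
Definition incr (a : nat) : cmd :=
  CSetI a (IConst 0) (IAdd (var a) (IConst 1)).

Definition measure_job : cmd :=
  CSeq (CSetR 3 (IConst 0) (RAdd (rvar 3) (p1_at (var 4))))
       (CIf (BAnd (BNot (in_A (var 4))) (BNot (BLeR (p2_at (var 4)) (rvar 4))))
            (CSetR 4 (IConst 0) (p2_at (var 4))) CSkip).

Definition reset_measure : cmd :=
  CSeq (CSetR 3 (IConst 0) RZero) (CSetR 4 (IConst 0) RZero).

(** The key of a job is p2 as long as it can be extracted, and P1 otherwise,
    that is for the jobs of A and those already extracted; the key P1 exceeds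
    p2 on B ([p2_lt_total1]). *)
Definition enter_job : cmd :=
  CSeq (CSetI 2 (IAdd (var 0) (var 4)) (var 4))
       (CIf (in_A (var 4)) (CSetR 2 (var 4) (rvar 3))
            (CSetR 2 (var 4) (p2_at (var 4)))).

Definition left_child : iexp := IAdd (var 4) (var 4).
Definition right_child : iexp := IAdd left_child (IConst 1).

Definition play : cmd :=
  CIf (BLeR (RGet 2 (IGet 2 left_child)) (RGet 2 (IGet 2 right_child)))
      (CSetI 2 (var 4) (IGet 2 left_child))
      (CSetI 2 (var 4) (IGet 2 right_child)).

Definition build_node : cmd :=
  CSeq (CSetI 3 left_child (var 4)) (CSeq (CSetI 3 right_child (var 4))
  (CSeq play (CSetI 4 (IConst 0) (ISub (var 4) (IConst 1))))).

Definition start_build : cmd := CSetI 4 (IConst 0) (ISub (var 0) (IConst 1)).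
Definition build_guard : bexp := BLeI (IConst 1) (var 4).

(** The extracted jobs come by nondecreasing p2 and fill the output from the
    end. *)
Definition pop : cmd :=
  CSeq (CSetI 7 (IConst 0) (IGet 2 (IConst 1)))
  (CSeq (CSetR 5 (IConst 0)
           (RAdd (rvar 5) (RSub (p1_at (var 7)) (p2_at (var 7)))))
  (CSeq (CSetR 2 (var 7) (rvar 3))
  (CSeq (CSetI 6 (IConst 0) (ISub (var 6) (IConst 1)))
  (CSeq (CSetI 1 (var 6) (var 7))
        (CSetI 4 (IConst 0) (IAdd (var 0) (var 7))))))).

Definition climb_guard : bexp := BLeI (IConst 2) (var 4).
Definition climb_step : cmd := CSeq (CSetI 4 (IConst 0) (IGet 3 (var 4))) play.

Definition start_extract : cmd :=
  CSeq (CSetR 5 (IConst 0) RZero) (CSetI 6 (IConst 0) (var 0)).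
Definition extract_guard : bexp := BNot (BLeR (rvar 4) (rvar 5)).

Definition collect_job (P : bexp) : cmd :=
  CIf P (CSeq (CSetI 1 (var 5) (var 4)) (incr 5)) CSkip.
Definition waiting : bexp := BNot (BLeR (rvar 3) (RGet 2 (var 4))).

Definition extract_step : cmd := CSeq pop (CWhile climb_guard climb_step).

Definition measure : cmd := CSeq reset_measure (for_jobs measure_job).
Definition build : cmd := CSeq start_build (CWhile build_guard build_node).
Definition extract : cmd :=
  CSeq start_extract (CWhile extract_guard extract_step).
Definition collect : cmd :=
  CSeq (CSetI 5 (IConst 0) (IConst 0))
  (CSeq (for_jobs (collect_job (in_A (var 4))))
        (for_jobs (collect_job waiting))).
Definition schedule_jobs : cmd :=
  CSeq measure (CSeq (for_jobs enter_job) (CSeq build (CSeq extract collect))).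

(** * Totals, keys and leaves *)

Section Preparation.
Variables (R : realType) (n : nat) (I : flowshop R n).
Implicit Type m : memory R.

Definition loaded m : Prop :=
  [/\ imem m 0 0 = n, forall j : 'I_n, rmem m 0 j = p1 I j
    & forall j : 'I_n, rmem m 1 j = p2 I j].

Lemma loaded_input : loaded (input_memory I).
Proof. by split=> // j /=; rewrite valK. Qed.

(** The real array 4 is only bracketed: at most pmaxB2, for termination, and at
    least p2 on B, for optimality. *)
Definition measured m : Prop :=
  [/\ loaded m, rmem m 3 0 = total1 I, rmem m 4 0 <= pmaxB2 I
    & forall j, j \in jobsB I -> p2 I j <= rmem m 4 0].

Lemma beval_in_A m (j : 'I_n) (e : iexp) :
  loaded m -> ieval m e = j -> beval m (in_A e) = (j \in jobsA I).
Proof. by case=> _ P1 P2 /= ->; rewrite P1 P2 inE. Qed.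

Lemma run_measure m :
  loaded m ->
  halts measure m
    (cost reset_measure + (cost measure_job + 20) * n.+1).+1 measured.
Proof.
move=> lm; pose Inv i m' := [/\ loaded m',
  rmem m' 3 0 = \sum_(j < n | (j < i)%N) p1 I j, rmem m' 4 0 <= pmaxB2 I
  & forall j : 'I_n, (j < i)%N -> j \in jobsB I -> p2 I j <= rmem m' 4 0].
apply: (halts_seq (P := Inv 0%N)).
  apply: halts_run => //; split=> //=; first by rewrite /update big_pred0.
  exact: bigmax_ge_id.
move=> m0 Inv0; apply: halts_weaken (halts_for_jobs _ _ _ _ Inv0) _ _ => //.
- by move=> i m' [[]].
- move=> i m' lt_in iE [lm' totE le_max geB]; have [szE P1 P2] := lm'.
  pose j := Ordinal lt_in.
  have sumE : rmem m' 3 0 + p1 I j = \sum_(j < n | (j < i.+1)%N) p1 I j.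
    rewrite totE [RHS](bigD1 j) //= addrC; congr (_ + _).
    by apply: eq_bigl => k; rewrite -val_eqE /=; lia.
  have AE : (p1 I j <= p2 I j) = (j \in jobsA I) by rewrite inE.
  rewrite [run _ _]/= /update /= iE !(P1 j, P2 j) AE.
  have jB : j \notin jobsA I -> j \in jobsB I by rewrite !inE ltNge.
  case: ifPn => /= cond; (split; first by []); split=> //=; rewrite ?iE //.
  - apply: (le_bigmax_cond 0 (p2 I)); apply: jB.
    by case/andP: cond.
  - move=> k ki kB; have [<- // | kj] := eqVneq k j.
    apply: le_trans (geB k _ kB) _.
      by move: kj; rewrite -val_eqE /=; lia.
    by apply: ltW; rewrite ltNge; case/andP: cond.
  move=> k ki kB; have [eq_kj | kj] := eqVneq k j; last first.
    by apply: geB => //; move: kj; rewrite -val_eqE /=; lia.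
  move: cond; rewrite -eq_kj negb_and !negbK; case/orP => //.
  by move: kB; rewrite !inE leNgt => ->.
move=> m' [lm' totE le_max geB]; split=> // [|j]; last exact: geB.
by rewrite totE; apply: eq_bigl => j; rewrite ltn_ord.
Qed.

Definition keyed (X : seq 'I_n) m : Prop :=
  measured m /\
  forall j : 'I_n, rmem m 2 j =
    if (j \in jobsA I) || (j \in X) then total1 I else p2 I j.

Lemma run_enter m :
  measured m ->
  halts (for_jobs enter_job) m ((cost enter_job + 20) * n.+1)
    (fun m' => keyed [::] m' /\
       forall j, (j < n)%N -> imem m' 2 (n + j)%N = j).
Proof.
move=> mm; pose Inv i m' := [/\ measured m',
    forall j : 'I_n, (j < i)%N -> rmem m' 2 j =
      if j \in jobsA I then total1 I else p2 I j
  & forall j, (j < i)%N -> imem m' 2 (n + j)%N = j].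
apply: halts_weaken (halts_for_jobs (n := n) (Inv := Inv) _ _ _ _ _) _ _ => //.
- by move=> i m' [[[]]].
- move=> i m' lt_in iE [mm' keyE leafE].
  have [[szE P1 P2] totE _ _] := mm'.
  pose j := Ordinal lt_in.
  have AE : (p1 I j <= p2 I j) = (j \in jobsA I) by rewrite inE.
  rewrite [run _ _]/= /update /= iE szE !(P1 j, P2 j) AE totE.
  case: ifPn => jA /=; (split; first by []);
    split=> //= [k ki | k ki]; rewrite ?iE ?szE.
  - case: eqP => [k_i | kj].
      by have -> : k = j; [apply: val_inj | rewrite jA].
    by apply: keyE; lia.
  - case: eqP => [|k_i]; first by lia.
    by apply: leafE; lia.
  - case: eqP => [k_i | kj].
      by have -> : k = j; [apply: val_inj | rewrite (negPf jA)].
    by apply: keyE; lia.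
  case: eqP => [|k_i]; first by lia.
  by apply: leafE; lia.
move=> m' [mm' keyE leafE]; split; last exact: leafE.
by split=> // j; rewrite orbF; apply: keyE.
Qed.
End Preparation.

(** * Building the tree and extracting the last jobs *)

Section Selection.
Variables (R : realType) (n : nat) (I : flowshop R n).
Implicit Type m : memory R.

Lemma run_play m (i := imem m 4 0) :
  run play m =
    Memory (update (imem m) 2 i
              (winner (rmem m 2) (imem m 2 i.*2) (imem m 2 i.*2.+1)))
           (rmem m).
Proof. by rewrite /= /i -addnn addn1 /winner; case: ifP. Qed.

Definition has_parents m (i : nat) : Prop :=
  forall v, (i < v < n.*2)%N -> imem m 3 v = v./2.

Lemma run_build m :
  (0 < n)%N -> keyed I [::] m ->
  (forall j, (j < n)%N -> imem m 2 (n + j)%N = j) ->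
  halts build m
    (cost start_build + ((bcost build_guard + cost build_node).+1 * n
       + (bcost build_guard).+1)).+1
    (fun m' => [/\ keyed I [::] m', has_parents m' 1, seeded n (imem m' 2)
                 & up_to_date n (rmem m' 2) (imem m' 2) 1]).
Proof.
move=> n_gt0 km leafE; pose Inv i m' := [/\ keyed I [::] m', imem m' 4 0 = i,
  (i < n)%N, has_parents m' i.*2.+1
  & seeded_from n (rmem m' 2) (imem m' 2) i].
have [[[szE _ _] _ _ _] _] := km.
apply: (halts_seq (P := Inv n.-1)).
  apply: halts_run => //; split; rewrite /= /update /= ?szE ?subn1 //.
  - by lia.
  - by move=> v vn; lia.
  exact: seeded_from_leaves.
move=> m0 Inv0.
have step k m' : Inv k m' -> beval m' build_guard ->
    (0 < k)%N /\ halts build_node m' (cost build_node) (Inv k.-1).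
  case: k => [|k] [km' iE k_n par seedm]; rewrite /= iE // => _; split=> //.
  apply: halts_run => //.
  have runE : run build_node m' =
      run (CSetI 4 (IConst 0) (ISub (var 4) (IConst 1)))
        (run play (run (CSetI 3 right_child (var 4))
                     (run (CSetI 3 left_child (var 4)) m'))) by [].
  rewrite runE run_play /= /update /= iE subn1; split=> //=.
  - by lia.
  - move=> v vn /=; case: eqP => [|v1]; first by lia.
    by case: eqP => [|v2]; [lia | apply: par; lia].
  exact: seeded_from_step.
apply: halts_weaken (halts_while step Inv0) _ _ => [|m' [nguard [k]]].
  by rewrite leq_add2r leq_mul2l leq_pred orbT.
case=> km' iE _ par seedm; move: nguard; rewrite /= iE -ltnNge ltnS leqn0.
move=> /eqP k0; rewrite k0 /= in par seedm.
by have [] := seeded_from0 seedm.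
Qed.

Definition stacked (X : seq 'I_n) m : Prop :=
  mkseq (fun k => imem m 1 (n - size X + k)%N) (size X) = map val X.

(** Invariant of the main loop, where X is the part of the output written so
    far. The tree is correct except at the proper ancestors of i. *)
Definition extracted (X : seq 'I_n) (i : nat) m : Prop :=
  [/\ [/\ keyed I X m, has_parents m 1, seeded n (imem m 2)
    & up_to_date n (rmem m 2) (imem m 2) i],
    rmem m 5 0 = gain I X, imem m 6 0 = (n - size X)%N, stacked X m
    & johnson_suffix I X].

(** The leaf is below 2n, hence below 2 ^ k.+1 for k = trunc_log 2 n + 1, and
    each step halves the node. *)
Lemma run_climb X m :
  extracted X (imem m 4 0) m -> (0 < imem m 4 0 < n.*2)%N ->
  halts (CWhile climb_guard climb_step) m
    ((bcost climb_guard + cost climb_step).+1 * (trunc_log 2 n).+1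
       + (bcost climb_guard).+1)
    (extracted X 1).
Proof.
move=> Xm i_n; pose Inv k m' := [/\ extracted X (imem m' 4 0) m',
  (0 < imem m' 4 0 < n.*2)%N & (imem m' 4 0 < 2 ^ k.+1)%N].
have step k m' : Inv k m' -> beval m' climb_guard ->
    (0 < k)%N /\ halts climb_step m' (cost climb_step) (Inv k.-1).
  move=> [Xm' i_n' i_k] /= i_gt1; set i := imem m' 4 0 in Xm' i_n' i_k i_gt1.
  split; first by case: k i_k => //; rewrite expn1; lia.
  have [[km' par seedm upd] gainE backE stackE sufX] := Xm'.
  apply: halts_run => //.
  have -> : run climb_step m' =
    run play (run (CSetI 4 (IConst 0) (IGet 3 (var 4))) m') by [].
  have parE : imem m' 3 i = i./2 by apply: par; lia.
  rewrite run_play /= /update /= -/i parE.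
  have [|seedm' upd'] := replay seedm upd (i := i); first by lia.
  split=> //=; first by lia.
  case: k i_k => [|k] /=; rewrite ?expn1 ?(expnS 2 k.+1) //; lia.
have Inv0 : Inv (trunc_log 2 n).+1 m.
  by split=> //; have := @trunc_log_ltn 2 n isT; rewrite (expnS 2 _.+1); lia.
apply: halts_weaken (halts_while step Inv0) _ _ => // m' [nguard [k []]].
move: nguard; rewrite /= -ltnNge => i_lt2 Xm' i_n' _.
by have <- : imem m' 4 0 = 1%N by lia.
Qed.

(** The champion has a key at most that of y, which is below P1, so it is a job
    of B that was not extracted yet, and it has the smallest p2 among those. *)
Lemma run_pop X m (y : 'I_n) :
  extracted X 1 m -> y \in jobsB I -> y \notin X ->
  exists w : 'I_n, extracted (w :: X) (n + w) (run pop m) /\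
                  imem (run pop m) 4 0 = (n + w)%N.
Proof.
move=> [[km par seedm upd] gainE backE stackE sufX] yB yX.
have n_gt0 : (0 < n)%N by apply: leq_ltn_trans (ltn_ord y).
have [[[szE P1 P2] totE le_max geB] keyE] := km.
have w_n : (imem m 2 1%N < n)%N by have [] := seedm.2 1%N; first by lia.
pose w := Ordinal w_n.
have keyB j : j \in jobsB I -> j \notin X -> rmem m 2 j = p2 I j.
  by rewrite keyE jobsAE => -> /negPf ->.
have min_w (j : 'I_n) : rmem m 2 w <= rmem m 2 j.
  by apply: champion_min seedm upd _.
have [wB wX] : w \in jobsB I /\ w \notin X.
  have := le_lt_trans (min_w y) (_ : _ < total1 I).
  rewrite keyB // => /(_ (p2_lt_total1 yB)); rewrite keyE; case: ifP.
    by rewrite ltxx.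
  by move/negbT; rewrite negb_or !inE -ltNge => /andP[].
have sizeX : (size X < n)%N.
  have [uX _ _ _] := sufX; have : uniq (w :: X) by rewrite /= wX.
  by move/card_uniqP => /= <-; rewrite -[n in (_ <= n)%N]card_ord max_card.
exists w; rewrite /= /update /= szE backE subn1.
pose key' j := if j == imem m 2 1%N then rmem m 3 0 else rmem m 2 j.
have upd' : up_to_date n key' (imem m 2) (n + w).
  by apply: up_to_date_change seedm upd _ => j _; rewrite /key' => /negPf /= ->.
split=> //; split=> //.
- split=> //; split; first by split.
  move=> j /=; rewrite in_cons -val_eqE /=.
  by case: eqP => [_|_] /=; rewrite ?orbT ?keyE ?totE.
- by rewrite /= (P1 w) (P2 w) gainE /gain big_cons addrC.
- by rewrite /= -subnS.
- rewrite /stacked /= subnS /mkseq /= addn0 eqxx /=; congr cons.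
  rewrite -stackE /mkseq -[1%N]addn0 iotaDl -map_comp.
  apply: eq_map => k /=.
  have -> : ((n - size X).-1 + (1 + k))%N = (n - size X + k)%N by lia.
  by case: eqP => //; lia.
apply: johnson_suffix_cons => // j jB jX.
by have := min_w j; rewrite !keyB.
Qed.

Definition extract_step_time : nat :=
  (cost pop + ((bcost climb_guard + cost climb_step).+1 * (trunc_log 2 n).+1
       + (bcost climb_guard).+1)).+1.

(** Each iteration adds a job to X, and X stays shorter than T as long as the
    gain is below pmaxB2; so #|T| bounds the number of iterations. *)
Lemma run_extract m (q : R) (T := [set i in jobsB I | p2 I i <= q]) :
  \sum_(i in T) p2 I i <= \sum_(i in T) p1 I i - pmaxB2 I ->
  [/\ keyed I [::] m, has_parents m 1, seeded n (imem m 2)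
    & up_to_date n (rmem m 2) (imem m 2) 1] ->
  halts extract m
    (cost start_extract + ((bcost extract_guard + extract_step_time).+1 * #|T|
       + (bcost extract_guard).+1)).+1
    (fun m' => exists X, extracted X 1 m' /\ rmem m' 4 0 <= gain I X).
Proof.
move=> sumT [km par seedm upd].
pose Inv k m' := exists2 X, extracted X 1 m' & (size X + k = #|T|)%N.
apply: (halts_seq (P := Inv #|T|)).
  have [[[szE P1 P2] totE le_max geB] keyE] := km.
  apply: halts_run => //; exists [::] => //; rewrite /= /update /= szE.
  split=> //=.
  - by rewrite /gain big_nil.
  - by rewrite subn0.
move=> m0 Inv0.
have step k m' : Inv k m' -> beval m' extract_guard ->
    (0 < k)%N /\ halts extract_step m' extract_step_time (Inv k.-1).
  move=> [X Xm' sizeX] guard.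
  have [[[[_ _ le_max _] _] _ _ _] gainE _ _ sufX] := Xm'.
  have gainX : gain I X < pmaxB2 I.
    by rewrite -gainE; move: guard; rewrite /= -ltNge => /lt_le_trans; apply.
  have [ltX [y yB yX]] := johnson_suffix_short sumT sufX gainX.
  rewrite -/T -sizeX in ltX; split; first by lia.
  have [w [Xpop nodeE]] := run_pop Xm' yB yX.
  apply: (halts_seq (P := fun m1 => m1 = run pop m')) => [|_ ->].
    exact: halts_run.
  have climb := run_climb (X := w :: X) (m := run pop m').
  rewrite nodeE in climb; have lt_wn := ltn_ord w.
  apply: (halts_weaken (climb Xpop _)) => // [|m1 Xm1]; first by lia.
  by exists (w :: X) => //; rewrite -sizeX /=; lia.
apply: halts_weaken (halts_while step Inv0) _ _ => // m' [nguard [k [X Xm' _]]].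
exists X; split=> //; have [_ <- _ _ _] := Xm'.
by move: nguard; rewrite /= negbK.
Qed.
End Selection.

(** * Writing the sequence *)

Section Collection.
Variables (R : realType) (n : nat) (I : flowshop R n).
Implicit Type m : memory R.

Definition collected (X Y : seq 'I_n) m : Prop :=
  [/\ keyed I X m, stacked X m, imem m 5 0 = size Y
    & mkseq (imem m 1) (size Y) = map val Y].

(** The front part never reaches the stack X at the end of the output, because
    the jobs written are distinct. *)
Lemma run_collect (guard : bexp) (P : pred 'I_n) (X Y : seq 'I_n) m :
  (forall m' (j : 'I_n), keyed I X m' -> imem m' 4 0 = j ->
     beval m' guard = P j) ->
  uniq (Y ++ X) -> (forall j, P j -> j \notin Y ++ X) ->
  collected X Y m ->
  halts (for_jobs (collect_job guard)) m
    ((cost (collect_job guard) + 20) * n.+1)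
    (collected X (Y ++ [seq j <- enum 'I_n | P j])).
Proof.
move=> guardE uYX newP Ym.
pose Y_ i := Y ++ [seq j <- take i (enum 'I_n) | P j].
pose Inv i m' := collected X (Y_ i) m'.
apply: halts_weaken (halts_for_jobs (n := n) (Inv := Inv) _ _ _ _ _) _ _ => //.
- by move=> i m' [[[[]]]].
- move=> i m' lt_in iE [km' stackE frontE outE].
  pose j := Ordinal lt_in.
  have takeE : take i.+1 (enum 'I_n) = rcons (take i (enum 'I_n)) j.
    rewrite (take_nth j) ?size_enum_ord //; congr rcons.
    by rewrite -[i]/(nat_of_ord j) nth_ord_enum.
  rewrite /Inv /Y_ takeE filter_rcons.
  rewrite [run _ _]/= (guardE m' j km' iE).
  have [Pj | nPj] := boolP (P j); last by [].
  rewrite -rcons_cat -/(Y_ i) /update /= frontE iE addn1.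
  have size_lt : (size (Y_ i) + size X < n)%N.
    have : uniq (rcons (Y_ i) j ++ X).
      have rconsE : rcons [seq k <- take i (enum 'I_n) | P k] j =
                    [seq k <- take i.+1 (enum 'I_n) | P k].
        by rewrite takeE filter_rcons Pj.
      rewrite /Y_ rcons_cat rconsE -catA uniq_catCA cat_uniq uYX andbT.
      rewrite filter_uniq ?take_uniq ?enum_uniq //=.
      apply/hasPn => k; rewrite mem_filter => kYX.
      by apply: contraL kYX => /andP[/newP].
    move/card_uniqP; rewrite size_cat size_rcons addSn => <-.
    by rewrite -[n in (_ <= n)%N]card_ord max_card.
  split=> //; split=> //=.
  - rewrite /stacked -[RHS](stackE : mkseq _ _ = _); apply/eq_in_map => k.
    by rewrite mem_iota /= => kX; case: eqP => //; lia.
  - by rewrite size_rcons.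
  rewrite size_rcons mkseqS eqxx map_rcons -outE; congr rcons.
  apply/eq_in_map => k; rewrite mem_iota /= => kY.
  by case: eqP => //; lia.
- by rewrite /Inv /Y_ take0 cats0.
by move=> m'; rewrite /Inv /Y_ take_oversize // size_enum_ord.
Qed.

Lemma beval_waiting (X : seq 'I_n) m (j : 'I_n) :
  keyed I X m -> imem m 4 0 = j ->
  beval m waiting = (j \in jobsB I) && (j \notin X).
Proof.
move=> [[_ totE _ _] keyE] jE; rewrite /= jE keyE totE -ltNge jobsAE.
have [jB | _] := boolP (j \in jobsB I); last by rewrite ltxx.
by case: (j \in X) => /=; [rewrite ltxx | rewrite p2_lt_total1].
Qed.

Definition collect_time : nat :=
  (cost (CSetI 5 (IConst 0) (IConst 0)) +
    ((cost (collect_job (in_A (var 4))) + 20) * n.+1 +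
     (cost (collect_job waiting) + 20) * n.+1).+1).+1.

Lemma run_collect_all (X : seq 'I_n) m :
  keyed I X m -> stacked X m -> uniq X -> {subset X <= jobsB I} ->
  halts collect m collect_time
    (collected X ([seq j <- enum 'I_n | j \in jobsA I] ++
                    [seq j <- enum 'I_n | (j \in jobsB I) && (j \notin X)])).
Proof.
move=> km stackE uX XB.
apply: (halts_seq (P := collected X [::])).
  by apply: halts_run.
move=> m0 m0E; have collectA gA uA newA := run_collect (guard := in_A (var 4))
  (P := fun j => j \in jobsA I) gA uA newA m0E.
apply: (halts_seq (collectA _ uX _)).
- by move=> m' j [[lm' _ _ _] _] jE; rewrite (beval_in_A (e := var 4) lm' jE).
- by move=> j; rewrite jobsAE; apply: contraNN => /XB.
move=> m1 m1E; apply: (run_collect _ _ _ m1E).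
- by move=> m' j km' jE; rewrite (beval_waiting km' jE).
- rewrite cat_uniq uX andbT filter_uniq ?enum_uniq //=.
  apply/hasPn => i /XB iB; rewrite mem_filter jobsAE iB //.
by move=> j /andP[jB jX]; rewrite mem_cat mem_filter jobsAE jB.
Qed.

Definition schedule_time (M : nat) : nat :=
  ((cost reset_measure + (cost measure_job + 20) * n.+1).+1 +
   ((cost enter_job + 20) * n.+1 +
    ((cost start_build + ((bcost build_guard + cost build_node).+1 * n
        + (bcost build_guard).+1)).+1 +
     ((cost start_extract + ((bcost extract_guard + extract_step_time n).+1 * M
        + (bcost extract_guard).+1)).+1 + collect_time).+1).+1).+1).+1.

Lemma run_schedule_jobs (q : R) (T := [set i in jobsB I | p2 I i <= q]) :
  (0 < n)%N -> total2 I <= total1 I - pmaxA1 I ->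
  \sum_(i in T) p2 I i <= \sum_(i in T) p1 I i - pmaxB2 I ->
  halts schedule_jobs (input_memory I) (schedule_time #|T|)
    (fun m => exists s, [/\ outputs m s, job_sequence s
                          & optimal I (perm_schedule I s)]).
Proof.
move=> n_gt0 P2P1 sumT.
apply: halts_seq (run_measure (loaded_input I)) _ => m1 m1E.
apply: halts_seq (run_enter m1E) _ => m2 [km2 leafE].
apply: halts_seq (run_build n_gt0 km2 leafE) _ => m3 m3E.
apply: halts_seq (run_extract sumT m3E) _ => m4.
move=> [X [[[km4 _ _ _] _ _ stackE sufX] gainX]].
have [uX XB _ _] := sufX.
apply: halts_weaken (run_collect_all km4 stackE uX XB) _ _ => // m5.
set Y : seq 'I_n := _ ++ _ => -[km5 stackE5 _ outE].
have geB : {in jobsB I, forall i, p2 I i <= rmem m4 4 0}.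
  by have [[_ _ _]] := km4.
have [job_s opt_s] := johnson_suffix_optimal P2P1 geB sufX gainX.
rewrite catA -/Y in job_s opt_s; exists (Y ++ X); split=> //.
have sizeYX : (size Y + size X)%N = n.
  by rewrite -size_cat (perm_size job_s) size_enum_ord.
have mkseqE : mkseq (imem m5 1) n = mkseq (imem m5 1) (size Y + size X).
  by rewrite sizeYX.
rewrite /outputs map_cat -outE -[map val X](stackE5 : mkseq _ _ = _) mkseqE.
rewrite [RHS]/mkseq iotaD map_cat; congr (_ ++ _).
rewrite add0n -[X in iota X](addn0 (size Y)) iotaDl -map_comp.
by apply: eq_map => k /=; congr (imem m5 1 _); lia.
Qed.
End Collection.

(** * The linear bound *)

(** Let L = trunc_log 2 n. If M * M <= n then L <= 2 sqrt (2 ^ L) gives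
    M * L <= 2 n. Otherwise 2 ^ L < M ^ 2, so L ln 2 <= 2 ln M, and
    M ln M <= n ln b gives M * L <= n * (2 ln b / ln 2). *)
Lemma extractions_linear (R : realType) (b : R) :
  1 < b ->
  exists C : nat, forall n M : nat,
    (M <= n)%N -> M%:R * log b M%:R <= n%:R -> (M * trunc_log 2 n <= C * n)%N.
Proof.
move=> b_gt1; have ln2 : 0 < ln (2 : R) by rewrite ln_gt0 // ltr1n.
have lnb : 0 < ln b by rewrite ln_gt0.
have := archi_boundP (ltW (divr_gt0 (mulr_gt0 (ltr0n R 2) lnb) ln2)).
set K := Num.bound _; rewrite ltr_pdivrMr // => ltK.
exists (K + 2)%N => n M leMn MlogM; set L := trunc_log 2 n.
have [n0 | n_gt0] := posnP n.
  by rewrite n0 leqn0 in leMn; rewrite (eqP leMn).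
have expL : (2 ^ L <= n)%N by apply: trunc_logP.
have [leMM | ltMM] := leqP (M * M) n.
  have sqL : ((L + 1) ^ 2 <= 4 * 2 ^ L)%N.
    elim: (L) => // l IHl; case: l IHl => // l.
    case: l => // l; rewrite [(2 ^ l.+3)%N]expnS; nia.
  have : ((M * L) ^ 2 <= (2 * n) ^ 2)%N by nia.
  by rewrite leq_sqr; nia.
have M_gt0 : (0 < M)%N by lia.
have lnM : L%:R * ln 2 <= 2 * ln (M%:R : R).
  rewrite !mulr_natl -!lnXn ?ltr0n //.
  rewrite ler_ln ?posrE ?exprn_gt0 ?ltr0n // -!natrX ler_nat.
  by rewrite (leq_trans expL) // ltnW // -mulnn.
have MlnM : M%:R * ln (M%:R : R) <= n%:R * ln b.
  by move: MlogM; rewrite /log mulrA ler_pdivrMr.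
suff : (M * L)%:R <= (K * n)%:R :> R by rewrite ler_nat; nia.
rewrite !natrM -(ler_pM2r ln2).
have M0 : 0 <= M%:R :> R by [].
have N0 : 0 <= n%:R :> R by [].
have := ler_wpM2l M0 lnM; have := ler_wpM2l N0 (ltW ltK); nra.
Qed.

Lemma schedule_time_linear (C : nat) :
  exists c, forall n M, (0 < n)%N -> (M <= n)%N ->
    (M * trunc_log 2 n <= C * n)%N -> (schedule_time n M <= c * n)%N.
Proof.
pose a := (cost reset_measure + cost measure_job + cost enter_job
  + cost start_build + (bcost build_guard + cost build_node).+1
  + bcost build_guard + cost start_extract + bcost extract_guard
  + cost (CSetI 5 (IConst 0) (IConst 0)) + cost (collect_job (in_A (var 4)))
  + cost (collect_job waiting) + 100)%N.
pose e := (bcost extract_guard + cost pop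
  + (bcost climb_guard + cost climb_step).+1 + bcost climb_guard + 20)%N.
pose d := (bcost climb_guard + cost climb_step).+1.
exists (2 * a + e + d * C)%N => n M n_gt0 leMn linC.
have le1 : (schedule_time n M <= a * n.+1 + e * M + d * (M * trunc_log 2 n))%N.
  rewrite /schedule_time /extract_step_time /collect_time /a /e /d.
  (* Only the shape of the bound matters, not the values of the constants. *)
  move: (cost reset_measure) (cost measure_job) (cost enter_job)
    (cost start_build) (bcost build_guard) (cost build_node)
    (cost start_extract) (bcost extract_guard) (cost (CSetI _ _ _))
    (cost (collect_job _)) (cost (collect_job _)) (cost pop)
    (bcost climb_guard) (cost climb_step) (trunc_log 2 n) => *.
  nia.
have : (d * (M * trunc_log 2 n) <= d * (C * n))%N.
  by rewrite leq_mul2l linC orbT.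
nia.
Qed.

Unset Implicit Arguments.

Theorem mainTheorem5 (R : realType) (b : R) (b_gt1 : 1 < b) :
  (forall (n : nat) (I : flowshop R n) (kB : 'I_n),
     johnson_indexed I ->
     total2 I <= total1 I - pmaxA1 I ->
     is_kB I kB ->
     forall sA sM : seq 'I_n,
       perm_eq sA [seq j : 'I_n <- enum 'I_n | (j < nA I)%N] ->
       perm_eq sM [seq j : 'I_n <- enum 'I_n | (nA I <= j < kB)%N] ->
       let s := sA ++ sM ++ [seq j : 'I_n <- enum 'I_n | (kB <= j)%N] in
       job_sequence s /\ optimal I (perm_schedule I s))
  /\
  (exists (algorithm : cmd) (c : nat),
     forall (n : nat) (I : flowshop R n) (sigma : 'S_n) (kB : 'I_n),
       johnson_indexed (relabel I sigma) ->
       total2 I <= total1 I - pmaxA1 I ->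
       is_kB (relabel I sigma) kB ->
       (n - kB)%:R * log b (n - kB)%:R <= n%:R ->
       exists (m : memory R) (t : nat) (s : seq 'I_n),
         [/\ exec algorithm (input_memory I) m t,
             (t <= c * n)%N,
             outputs m s,
             job_sequence s
           & optimal I (perm_schedule I s)]).
Proof.
split=> [n I k jI P2P1 [condk _] sA sM permA permM|].
  exact: johnson_order_optimal.
have [C linC] := extractions_linear b_gt1.
have [c timec] := schedule_time_linear C.
exists schedule_jobs, c => n I sigma k jI P2P1 [condk _] klogk.
have n_gt0 : (0 < n)%N by apply: leq_ltn_trans (ltn_ord k).
have [cardT sumT] := relabel_tail jI condk.
have [m [t [run_m leT [s [outE job_s opt_s]]]]] :=
  run_schedule_jobs n_gt0 P2P1 sumT.
exists m, t, s; split=> //; apply: leq_trans leT _; rewrite cardT.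
by apply: timec; rewrite ?leq_subr // linC ?leq_subr.
Qed.
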